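(* For positive integers $k\le n$, $$ s(k,n)\le n+k^2\left(\frac14-\frac1{(\pi+2)^2}+o(1)\right),$$ where $o(1)$ denotes a quantity tending to $0$ as $n\to\infty$.
   Context: $[n]=\{1,\dots,n\}$. For a set $A$ of integers, $A+A=\{a+b: a,b\in A\}$. Define $s(k,n)=\max\{|A+A| : A\subseteq[n],\ |A|=k\}$. *)

(* Defs.v *)
From mathcomp Require Import all_boot.
From Stdlib Require Import Reals.

Set Implicit Arguments.
Unset Strict Implicit.
Unset Printing Implicit Defensive.

Definition sumset_card (A : seq nat) : nat :=
  size (undup [seq a + b | a <- A, b <- A]).

(* [n] = {1,...,n} is represented as the elements of 'I_(n.+1) other than 0. *)
Definition s (k n : nat) : nat :=
  \max_(A : {set 'I_n.+1} | (#|A| == k) && (ord0 \notin A))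
     sumset_card [seq val x | x <- enum A].

(* Main.v *)
(**
Write k = #|A|, S = |A + A| and let r(x) be the number of ordered pairs of
elements of A with sum x, so that r lives on [1, 2n].  For t = j pi / n with
0 < j < 2n the full sum of e^(i t x) over [1, 2n] vanishes, hence
|sum_(a in A) e^(i t a)|^2 = |sum_x (r(x) - 2) e^(i t x)|
<= sum_x |r(x) - 2| <= k^2 + 4n + 2k - 4S =: G^2.
On [0, n] the function sin (pi a / n) coincides with its n-periodic extension.
The finite cosine expansion of the latter has constant term c / n, where
c = cot (pi / 2n), and all its other coefficients are nonpositive; as the
function vanishes at 0, their absolute values add up to c / n.  Summing the
expansion over A and bounding each exponential sum by G gives c k <= (n + c) G;
as c / n tends to 2 / pi, this is G >= (2 / (pi + 2) - o(1)) k, an upper bound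
on S.
*)

Require Import Defs.
From mathcomp Require Import all_boot all_order all_algebra.
From mathcomp Require Import Rstruct.
From Stdlib Require Import Reals.
From mathcomp Require Import zify ring lra.

Set Implicit Arguments.
Unset Strict Implicit.
Unset Printing Implicit Defensive.

Import Order.TTheory GRing.Theory Num.Theory.
(* Stdlib's R_scope would otherwise capture the operations on R. *)
Local Open Scope ring_scope.
Bind Scope ring_scope with R.
Local Arguments sin : clear scopes.
Local Arguments cos : clear scopes.
Delimit Scope nat_scope with N.

(** * Trigonometric identities over the real numbers *)

Lemma sinD x y : sin (x + y) = sin x * cos y + cos x * sin y.
Proof. exact: sin_plus. Qed.

Lemma cosD x y : cos (x + y) = cos x * cos y - sin x * sin y.
Proof. exact: cos_plus. Qed.

Lemma sinN x : sin (- x) = - sin x.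
Proof. exact: sin_neg. Qed.

Lemma cosN x : cos (- x) = cos x.
Proof. exact: cos_neg. Qed.

Lemma cos2Dsin2 x : cos x ^+ 2 + sin x ^+ 2 = 1.
Proof. by have := sin2_cos2 x; rewrite /Rsqr !RealsE addrC -!expr2. Qed.

Lemma sin_PI0 : sin PI = 0. Proof. exact: sin_PI. Qed.

Lemma cos_PIN1 : cos PI = - 1. Proof. exact: cos_PI. Qed.

Lemma PI_gt0 : 0 < PI.
Proof. by apply/RltP; exact: PI_RGT_0. Qed.

Lemma sin_gt0 x : 0 < x -> x < PI -> 0 < sin x.
Proof. by move=> /RltP x0 /RltP xPI; apply/RltP; apply: sin_gt_0. Qed.

Lemma cos_ge0 x : 0 <= x -> x <= PI / 2 -> 0 <= cos x.
Proof.
move=> x0 /RleP xPI; apply/RleP; apply: cos_ge_0 => //.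
by apply/RleP; have := PI_gt0; change (0 < PI -> - (PI / 2) <= x); lra.
Qed.

Lemma sin_le x : 0 <= x -> sin x <= x.
Proof.
rewrite le_eqVlt => /predU1P[<-|/RltP x0]; first by rewrite sin_0.
by apply/ltW/RltP; exact: sin_lt_x.
Qed.

Lemma sin_mulnPI m : sin (m%:R * PI) = 0.
Proof.
elim: m => [|m IHm]; first by rewrite mul0r; exact: sin_0.
by rewrite -natr1 mulrDl mul1r sinD IHm sin_PI0 mul0r mulr0 addr0.
Qed.

Lemma cos_muln2PI m : cos (m.*2%:R * PI) = 1.
Proof.
elim: m => [|m IHm]; first by rewrite mul0r; exact: cos_0.
have -> : m.+1.*2%:R * PI = m.*2%:R * PI + PI + PI.
  by rewrite doubleS -!natr1; ring.
by rewrite 2!cosD sinD IHm sin_mulnPI sin_PI0 cos_PIN1; ring.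
Qed.

Lemma natrM2 (m : nat) : m.*2%:R = 2 * m%:R :> R.
Proof. by rewrite -mul2n natrM. Qed.

(** * Vanishing cosine sums along arithmetic progressions *)

Lemma sum_cos_ap u t m :
  sin t * \sum_(j < m) cos (u + j.*2.+1%:R * t)
  = cos (u + m%:R * t) * sin (m%:R * t).
Proof.
(* This product formula turns each summand into half a difference of consecutive sines, so the sum
   telescopes. *)
have cos_sinE x y : cos x * sin y = (sin (x + y) - sin (x - y)) / 2.
  by rewrite !sinD cosN sinN; field.
elim: m => [|m IHm]; first by rewrite big_ord0 mulr0 mul0r sin_0 mulr0.
rewrite big_ord_recr mulrDr IHm [sin t * _]mulrC !cos_sinE -mulrDl /=.
congr (_ / _).
have -> : u + m.*2.+1%:R * t + t = u + m.+1%:R * t + m.+1%:R * t.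
  by rewrite -!natr1 natrM2; ring.
have -> : u + m.*2.+1%:R * t - t = u + m%:R * t + m%:R * t.
  by rewrite -natr1 natrM2; ring.
by rewrite !addrK; ring.
Qed.

Lemma sum_cos_eq0 u t m :
  sin t != 0 -> sin (m%:R * t) = 0 ->
  \sum_(j < m) cos (u + j.*2.+1%:R * t) = 0.
Proof.
move=> t0 mt0; apply: (mulfI t0).
by rewrite sum_cos_ap mt0 !mulr0.
Qed.

Lemma sum_cos_period (n j : nat) (u : R) : (0 < j < n.*2)%N ->
  \sum_(x < n.*2) cos (u + x%:R * (j%:R * (PI / n%:R))) = 0.
Proof.
move=> /andP[j0 jn]; have n0 : (0 < n)%N by lia.
have n0R : 0 < n%:R :> R by rewrite ltr0n.
(* [t] is half the step of the progression: its odd multiples, added to [u - t], give the required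
   arguments. *)
set t := j%:R * PI / n.*2%:R.
have n2R : 0 < n.*2%:R :> R by rewrite ltr0n double_gt0.
rewrite -[RHS](@sum_cos_eq0 (u - t) t n.*2).
- apply: eq_bigr => x _; congr cos; rewrite /t -natr1 !natrM2.
  by field; rewrite gt_eqF.
- rewrite gt_eqF// sin_gt0// /t.
    by rewrite divr_gt0// mulr_gt0 ?PI_gt0 ?ltr0n.
  by rewrite ltr_pdivrMr// mulrC ltr_pM2l ?PI_gt0// ltr_nat.
- have -> : n.*2%:R * t = j%:R * PI by rewrite /t; field; rewrite gt_eqF.
  exact: sin_mulnPI.
Qed.

(** * Finite cosine expansion of the sine *)

Definition cotg x : R := cos x / sin x.

Section FiniteFourier.
Variable n : nat.
Hypothesis n_gt0 : (0 < n)%N.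
Let th : R := PI / n.*2%:R.
Let psi (j : nat) : R := j.*2.+1%:R * th.

Let n2R : 0 < n.*2%:R :> R. Proof. by rewrite ltr0n double_gt0. Qed.
Let th_gt0 : 0 < th. Proof. by rewrite divr_gt0 ?PI_gt0. Qed.
Let n2th : n.*2%:R * th = PI. Proof. by rewrite mulrC divfK ?gt_eqF. Qed.

Let sin_psi_gt0 j : (j < n)%N -> 0 < sin (psi j).
Proof.
move=> jn; apply: sin_gt0; first by rewrite mulr_gt0 ?ltr0n.
by rewrite -n2th /psi ltr_pM2r// ltr_nat; lia.
Qed.

(** Cross-multiplied, the difference is the sine of the gap between two nodes. This fixes the sign
    of the coefficients in [sin_cos_expansion]. *)
Lemma cotg_psi_decr j : (j.+1 < n)%N -> cotg (psi j.+1) <= cotg (psi j).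
Proof.
move=> jn.
have s1 := sin_psi_gt0 jn; have s0 : 0 < sin (psi j) by apply: sin_psi_gt0; lia.
rewrite /cotg ler_pdivrMr// mulrAC ler_pdivlMr// -subr_ge0.
have -> : cos (psi j) * sin (psi j.+1) - cos (psi j.+1) * sin (psi j)
    = sin (psi j.+1 - psi j) by rewrite sinD cosN sinN; ring.
have -> : psi j.+1 - psi j = 2 * th by rewrite /psi doubleS -!natr1; ring.
apply/ltW/sin_gt0; first by rewrite mulr_gt0.
by rewrite -n2th ltr_pM2r// ltr_nat; lia.
Qed.

(** The nodes are symmetric about pi / 2. This evaluates the last boundary term of the summation by
    parts and the total of the coefficients. *)
Lemma cotg_psi_last : cotg (psi n.-1) = - cotg (psi 0).
Proof.
have -> : psi n.-1 = PI - psi 0.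
  by rewrite -n2th /psi; case: n n_gt0 => // m _ /=;
    rewrite double0 doubleS -!natr1; ring.
rewrite /cotg sinD cosD sinN cosN sin_PI0 cos_PIN1 !mul0r add0r !mulN1r opprK.
by rewrite subr0 mulNr.
Qed.

Lemma sum_cos_psi i : (0 < i < n)%N -> \sum_(j < n) cos (i.*2%:R * psi j) = 0.
Proof.
move=> /andP[i0 iN].
rewrite -[RHS](@sum_cos_eq0 0 (i.*2%:R * th) n).
- by apply: eq_bigr => j _; congr cos; rewrite /psi; ring.
- rewrite gt_eqF// sin_gt0//; first by rewrite mulr_gt0// ltr0n double_gt0.
  by rewrite -n2th ltr_pM2r// ltr_nat; lia.
- have -> : n%:R * (i.*2%:R * th) = i%:R * PI.
    by rewrite -n2th !natrM2; ring.
  exact: sin_mulnPI.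
Qed.

(** Raising [a] by 1 adds 2 cos (psi j) cos ((2a + 1) psi j) = cos (2(a + 1) psi j) + cos (2a psi j)
    to each term. These cosines sum to 0 over the nodes, except at frequency 0, where they give
    n. *)
Lemma sum_cotg_sin a : (0 < a < n)%N ->
  \sum_(j < n) cotg (psi j) * sin (a.*2%:R * psi j) = n%:R.
Proof.
have step b : \sum_(j < n) cotg (psi j) * sin (b.+1.*2%:R * psi j)
    = \sum_(j < n) cotg (psi j) * sin (b.*2%:R * psi j)
      + \sum_(j < n) cos (b.+1.*2%:R * psi j)
      + \sum_(j < n) cos (b.*2%:R * psi j).
  rewrite -!big_split; apply: eq_bigr => j _ /=.
  have s0 := sin_psi_gt0 (ltn_ord j).
  have -> : b.+1.*2%:R * psi j = b.*2.+1%:R * psi j + psi j.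
    by rewrite doubleS -!natr1; ring.
  have -> : b.*2%:R * psi j = b.*2.+1%:R * psi j - psi j.
    by rewrite -!natr1; ring.
  by rewrite /cotg !(sinD, cosD, sinN, cosN); field; rewrite gt_eqF.
elim: a => // a IHa /andP[_ an].
rewrite step sum_cos_psi ?an// addr0.
case: a IHa an => [_ _|a IHa an]; last first.
  by rewrite IHa ?sum_cos_psi ?addr0//; lia.
rewrite big1 ?add0r => [|j _]; last by rewrite mul0r sin_0 mulr0.
rewrite (eq_bigr (fun=> 1)) => [|j _]; last by rewrite mul0r; exact: cos_0.
by rewrite sumr_const card_ord.
Qed.

(** Multiplying [sum_cotg_sin] by 2 sin (2a th) makes each sine a difference of cosines; summation
    by parts then moves the differences onto the cotangents. *)
Lemma sin_cos_expansion a : (0 < a <= n)%N ->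
  n.*2%:R * sin (a.*2%:R * th)
  = 2 * cotg (psi 0) - \sum_(i < n.-1)
      (cotg (psi i) - cotg (psi i.+1)) * cos ((a.*2 * i.+1.*2)%:R * th).
Proof.
move=> /andP[a0 an].
pose g i := cos ((a.*2 * i.*2)%:R * th).
have -> : n.*2%:R * sin (a.*2%:R * th)
    = \sum_(j < n) cotg (psi j) * (g j - g j.+1).
  have -> : \sum_(j < n) cotg (psi j) * (g j - g j.+1)
      = 2 * sin (a.*2%:R * th)
        * \sum_(j < n) cotg (psi j) * sin (a.*2%:R * psi j).
    rewrite mulr_sumr; apply: eq_bigr => j _.
    have gE (e : R) i : (a.*2 * i.*2)%:R * th
        = a.*2%:R * psi j + e * (a.*2%:R * th) -> g i
        = cos (a.*2%:R * psi j + e * (a.*2%:R * th)) by rewrite /g => ->.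
    rewrite (gE (- 1) j) ?(gE 1 j.+1) ?mulN1r ?mul1r ?cosD ?cosN ?sinN.
    - by ring.
    - by rewrite /psi natrM doubleS -!natr1; ring.
    - by rewrite /psi natrM -!natr1; ring.
  (* At a = n, outside the range of [sum_cotg_sin], both sides vanish because sin pi = 0. *)
  have [->|aN] := eqVneq a n; first by rewrite n2th sin_PI0; ring.
  by rewrite sum_cotg_sin ?a0 ?ltn_neqAle ?aN// natrM2; ring.
have gn : g n = 1.
  have -> : 1 = cos (a.*2%:R * PI) by rewrite cos_muln2PI.
  by rewrite /g -n2th natrM mulrA.
have g0 : g 0%N = 1 by rewrite /g muln0 mul0r; exact: cos_0.
(* Summation by parts; as [g] is 1 at both ends, the boundary terms add up to 2 cotg (psi 0). *)
have abel m : \sum_(j < m.+1) cotg (psi j) * (g j - g j.+1)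
    = cotg (psi 0) * g 0%N - cotg (psi m) * g m.+1
      - \sum_(i < m) (cotg (psi i) - cotg (psi i.+1)) * g i.+1.
  elim: m => [|m IHm]; first by rewrite big_ord_recr !big_ord0 /=; ring.
  by rewrite big_ord_recr IHm [in RHS]big_ord_recr /=; ring.
have := abel n.-1; rewrite prednK// gn g0 cotg_psi_last => ->.
by ring.
Qed.

End FiniteFourier.

(** * Triangle inequality for weighted sums of unit vectors, in real coordinates *)

Lemma norm_sum_le (I : finType) (w c s : I -> R) :
  (forall i, c i ^+ 2 + s i ^+ 2 = 1) ->
  (\sum_i w i * c i) ^+ 2 + (\sum_i w i * s i) ^+ 2 <= (\sum_i `|w i|) ^+ 2.
Proof.
move=> cs1; set X := \sum_i w i * c i; set Y := \sum_i w i * s i.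
set W := \sum_i _; have W0 : 0 <= W by apply: sumr_ge0.
have r20 : 0 <= X ^+ 2 + Y ^+ 2 by rewrite addr_ge0 ?sqr_ge0.
set r := Num.sqrt (X ^+ 2 + Y ^+ 2); have r0 : 0 <= r by exact: sqrtr_ge0.
have r2E : r ^+ 2 = X ^+ 2 + Y ^+ 2 by exact: sqr_sqrtr.
have dir_le i : `|X * c i + Y * s i| <= r.
  rewrite -sqrtr_sqr ler_wsqrtr//.
  (* Lagrange's identity, giving the Cauchy-Schwarz inequality. *)
  have -> : (X * c i + Y * s i) ^+ 2
      = (X ^+ 2 + Y ^+ 2) * (c i ^+ 2 + s i ^+ 2) - (X * s i - Y * c i) ^+ 2.
    by ring.
  by rewrite cs1 mulr1 gerBl sqr_ge0.
(* The resultant (X, Y) is projected onto itself, term by term. *)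
have rrW : r * r <= W * r.
  have -> : r * r = \sum_i w i * (X * c i + Y * s i).
    rewrite -expr2 r2E !expr2 {1}/X {1}/Y !mulr_suml -big_split /=.
    by apply: eq_bigr => i _; ring.
  rewrite mulr_suml ler_sum// => i _.
  by rewrite (le_trans (ler_norm _))// normrM ler_wpM2l.
rewrite -r2E; have [->|rn0] := eqVneq r 0; first by rewrite expr0n sqr_ge0.
have rp : 0 < r by rewrite lt_def rn0.
by rewrite ler_pXn2r// -(ler_pM2r rp).
Qed.

(** * Representation counts and exponential sums of a set in [1, n] *)

Section Sumset.
Variables (n : nat) (A : {set 'I_n.+1}).
Hypothesis A0 : ord0 \notin A.

Definition rep (x : nat) : nat :=
  #|[set p in setX A A | (p.1 + p.2 == x :> nat)%N]|.

Let sumset := sumset_card [seq val x | x <- enum A].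

Lemma mem_gt0 (a : 'I_n.+1) : a \in A -> (0 < a)%N.
Proof.
move=> aA; rewrite lt0n; apply: contraNneq A0 => a0.
by rewrite (_ : ord0 = a)//; apply: val_inj.
Qed.

(** Here and below, sums over [1, m] are indexed by [x < m] through [x.+1]. *)
Lemma sum_hit (m c : nat) (f : nat -> R) : (0 < c <= m)%N ->
  \sum_(x < m) (c == x.+1)%:R * f x.+1 = f c.
Proof.
case: c => // c cm; rewrite (bigD1 (Ordinal cm))//= eqxx mul1r big1 ?addr0//.
move=> i; rewrite -val_eqE eqSS eq_sym /= => /negPf ->.
by rewrite mul0r.
Qed.

(** Double counting: each pair is counted once, at x = a + b, which lies in [1, 2n] because [A]
    avoids 0. *)
Lemma sum_rep (f : nat -> R) :
  \sum_(x < n.*2) (rep x.+1)%:R * f x.+1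
  = \sum_(a in A) \sum_(b in A) f (a + b)%N.
Proof.
rewrite pair_big /=.
have repE x : (rep x)%:R
    = \sum_(p | (p.1 \in A) && (p.2 \in A)) (p.1 + p.2 == x)%N%:R :> R.
  rewrite /rep -sum1_card natr_sum big_mkcond [RHS]big_mkcond.
  apply: eq_bigr => p _; rewrite !inE.
  by case: (p.1 \in A); case: (p.2 \in A); case: (_ == x).
under eq_bigr do rewrite repE mulr_suml.
rewrite exchange_big; apply: eq_bigr => -[a b] /= /andP[/mem_gt0 a0 _].
by apply: sum_hit; have := ltn_ord a; have := ltn_ord b; lia.
Qed.

Lemma rep_gt0 x :
  (0 < rep x)%N
  = (x \in [seq (a + b)%N | a <- [seq val x | x <- enum A],
                            b <- [seq val x | x <- enum A]]).
Proof.
apply/card_gt0P/allpairsP => [[[a b]]|].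
  rewrite !inE /= => /andP[/andP[aA bA] /eqP <-].
  by exists (val a, val b); split=> //=; apply: map_f; rewrite mem_enum.
move=> [[_ _] [/= /mapP[a aA ->] /mapP[b bA ->] ->]].
move: aA bA; rewrite !mem_enum => aA bA.
by exists (a, b); rewrite !inE aA bA /=.
Qed.

Lemma sumsetE : sumset = (\sum_(x < n.*2) (0 < rep x.+1))%N.
Proof.
rewrite /sumset /sumset_card; set s := [seq _ | _ <- _, _ <- _].
have /perm_size -> : perm_eq (undup s) [seq x <- iota 1 n.*2 | (0 < rep x)%N].
  apply: uniq_perm; rewrite ?undup_uniq ?filter_uniq ?iota_uniq// => x.
  rewrite mem_undup mem_filter rep_gt0 -/s; case xs : (x \in s) => //=.
  have := xs; rewrite -rep_gt0 => /card_gt0P[[a b]]; rewrite !inE /=.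
  move=> /andP[/andP[/mem_gt0 a0 _] /eqP <-]; rewrite mem_iota.
  by have := ltn_ord a; have := ltn_ord b; lia.
rewrite size_filter -sum1_count big_mkcond /=.
rewrite -(big_mkord xpredT (fun x => (0 < rep x.+1)%N : nat)).
have -> : iota 1 n.*2 = index_iota 1 n.*2.+1 by rewrite /index_iota subn1.
rewrite big_add1 /=.
by apply: eq_bigr => i _; case: ifP.
Qed.

(* By symmetry of the sum, a unique representation is of the form a + a. *)
Lemma rep_eq1 x : rep x = 1%N -> exists2 a, a \in A & (a + a == x)%N.
Proof.
move=> /eqP/cards1P[[a b] abE].
have : (a, b) \in [set p in setX A A | (p.1 + p.2 == x :> nat)%N].
  by rewrite abE set11.
rewrite !inE /= => /andP[/andP[aA bA] abx].
have : (b, a) \in [set p in setX A A | (p.1 + p.2 == x :> nat)%N].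
  by rewrite !inE /= aA bA addnC.
by rewrite abE inE => /eqP[ba _]; exists a; rewrite // -{2}ba.
Qed.

Lemma sum_rep_dev :
  \sum_(x < n.*2) `|(rep x.+1)%:R - 2|
  <= #|A|%:R ^+ 2 + 4 * n%:R + 2 * #|A|%:R - 4 * sumset%:R :> R.
Proof.
(* [d x] counts the a with 2a = x. It pays for r(x) = 1, the only case where |r - 2| exceeds r + 2 -
   4 [r > 0]; by symmetry such an x is a double. *)
pose d x : nat := (\sum_(a in A) (a + a == x))%N.
have d_sum : \sum_(x < n.*2) (d x.+1)%:R = #|A|%:R :> R.
  under eq_bigr do rewrite /d natr_sum.
  rewrite exchange_big -sum1_card natr_sum; apply: eq_bigr => a /mem_gt0 a0 /=.
  rewrite -[RHS](@sum_hit n.*2 (a + a) (fun=> 1)); last first.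
    by have := ltn_ord a; lia.
  by apply: eq_bigr => x _; rewrite mulr1.
have rep_sum : \sum_(x < n.*2) (rep x.+1)%:R = #|A|%:R ^+ 2 :> R.
  under eq_bigr do rewrite -[_%:R]mulr1.
  by rewrite (sum_rep (fun=> 1)) !sumr_const expr2 -natrM mulrnA.
have pointwise x : `|(rep x)%:R - 2|
    <= (rep x)%:R + 2 - 4 * (0 < rep x)%N%:R + 2 * (d x)%:R :> R.
  case repx : (rep x) => [|[|r]].
  - by rewrite sub0r normrN normr_nat /=; have := ler0n R (d x); lra.
  - have [a aA aax] := rep_eq1 repx.
    have : 1 <= (d x)%:R :> R.
      by rewrite ler1n /d (bigD1 a)//= aax.
    by rewrite /= distrC ger0_norm; lra.
  - rewrite -addn2 natrD addrK normr_nat addn2 /=; have := ler0n R (d x).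
    by have := ler0n R r; lra.
apply: le_trans; first by apply: ler_sum => x _; exact: pointwise.
rewrite !big_split sumrN -!mulr_sumr /= rep_sum d_sum sumr_const card_ord.
rewrite sumsetE natr_sum -mulr_natr natrM2; lra.
Qed.

(** With z = C + iS the sum of e^(ita) over [A], z^2 is the sum of r(x) e^(itx). Replacing r by r -
    2 changes nothing, as the full sums vanish, and the triangle inequality bounds |z|^2. *)
Lemma exp_sum_bound j : (0 < j < n.*2)%N ->
  (\sum_(a in A) cos (a%:R * (j%:R * (PI / n%:R)))) ^+ 2
  + (\sum_(a in A) sin (a%:R * (j%:R * (PI / n%:R)))) ^+ 2
  <= #|A|%:R ^+ 2 + 4 * n%:R + 2 * #|A|%:R - 4 * sumset%:R.
Proof.
move=> jn; apply: le_trans sum_rep_dev; set t := j%:R * _.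
set C := \sum_(a in A) cos _; set S := \sum_(a in A) sin _.
pose w (x : 'I_n.*2) : R := (rep x.+1)%:R - 2.
have cosE : \sum_x w x * cos (x.+1%:R * t) = C ^+ 2 - S ^+ 2.
  under eq_bigr do rewrite /w mulrBl.
  rewrite sumrB (sum_rep (fun x => cos (x%:R * t))) -mulr_sumr.
  under [X in _ - _ * X]eq_bigr do rewrite -natr1 mulrDl mul1r addrC.
  rewrite sum_cos_period// mulr0 subr0 !expr2 !big_distrlr /= -sumrB.
  apply: eq_bigr => a _; rewrite -sumrB; apply: eq_bigr => b _.
  by rewrite natrD mulrDl cosD.
have sinE : \sum_x w x * sin (x.+1%:R * t) = 2 * (C * S).
  under eq_bigr do rewrite /w mulrBl.
  rewrite sumrB (sum_rep (fun x => sin (x%:R * t))) -mulr_sumr.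
  (* A sine is a cosine shifted by pi / 2, so [sum_cos_period] applies again. *)
  have -> : \sum_(x < n.*2) sin (x.+1%:R * t)
      = \sum_(x < n.*2) cos ((t - PI / 2) + x%:R * t).
    apply: eq_bigr => x _.
    have -> : sin (x.+1%:R * t) = cos (x.+1%:R * t - PI / 2).
      have s1 : sin (PI / 2) = 1 by exact: sin_PI2.
      have c0 : cos (PI / 2) = 0 by exact: cos_PI2.
      by rewrite cosD cosN sinN s1 c0; ring.
    by congr cos; rewrite -natr1; ring.
  rewrite sum_cos_period// mulr0 subr0.
  have -> : 2 * (C * S) = S * C + C * S by ring.
  rewrite !big_distrlr /= -big_split; apply: eq_bigr => a _.
  rewrite -big_split; apply: eq_bigr => b _.
  by rewrite natrD mulrDl sinD.
have := @norm_sum_le _ w (fun x => cos (x.+1%:R * t))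
  (fun x => sin (x.+1%:R * t)) (fun x => cos2Dsin2 _).
rewrite cosE sinE.
have -> : (C ^+ 2 - S ^+ 2) ^+ 2 + (2 * (C * S)) ^+ 2 = (C ^+ 2 + S ^+ 2) ^+ 2.
  by ring.
by rewrite ler_pXn2r// nnegrE ?addr_ge0 ?sqr_ge0// sumr_ge0.
Qed.

(** With c = cotg th, the expansion summed over [A] writes 2 c k as 2n times a sine sum plus a
    combination of cosine sums with nonnegative weights of total 2c. Each of these sums is at most
    G. *)
Lemma sumset_cotg_bound (G : R) : (0 < n)%N -> 0 <= G ->
  G ^+ 2 = #|A|%:R ^+ 2 + 4 * n%:R + 2 * #|A|%:R - 4 * sumset%:R ->
  cotg (PI / n.*2%:R) * #|A|%:R <= (n%:R + cotg (PI / n.*2%:R)) * G.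
Proof.
move=> n0 G0 G2; set th := PI / n.*2%:R.
have n0R : n%:R != 0 :> R by rewrite pnatr_eq0 -lt0n.
have angleE (a i : nat) : (a.*2 * i)%:R * th = a%:R * (i%:R * (PI / n%:R)).
  by rewrite /th natrM !natrM2; field.
have norm_le (u v : R) : u ^+ 2 + v ^+ 2 <= G ^+ 2 -> (u <= G) && (v <= G).
  move=> uvG; have uG : `|u| <= G.
    by rewrite -ler_sqr ?nnegrE// real_normK ?num_real//; nra.
  have vG : `|v| <= G.
    by rewrite -ler_sqr ?nnegrE// real_normK ?num_real//; nra.
  by rewrite (le_trans (ler_norm u)) ?(le_trans (ler_norm v)).
have bnd j (jn : (0 < j < n.*2)%N) :
    (\sum_(a in A) cos (a%:R * (j%:R * (PI / n%:R))) <= G)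
    && (\sum_(a in A) sin (a%:R * (j%:R * (PI / n%:R))) <= G).
  by apply: norm_le; rewrite G2; exact: exp_sum_bound.
pose K (j : nat) := cotg (j.*2.+1%:R * th).
have expansion : n.*2%:R * \sum_(a in A) sin (a.*2%:R * th)
    = 2 * K 0%N * #|A|%:R
      - \sum_(i < n.-1) (K i - K i.+1)
          * \sum_(a in A) cos ((a.*2 * i.+1.*2)%:R * th).
  under [X in _ - X]eq_bigr do rewrite mulr_sumr.
  rewrite exchange_big mulr_sumr -sum1_card natr_sum mulr_sumr -sumrB.
  apply: eq_bigr => a aA; rewrite mulr1 sin_cos_expansion//.
  by rewrite (mem_gt0 aA) -ltnS ltn_ord.
have K0E : K 0%N = cotg th by rewrite /K mul1r.
have telescope : \sum_(i < n.-1) (K i - K i.+1) = 2 * K 0%N.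
  rewrite -(big_mkord xpredT (fun i => K i - K i.+1)).
  under eq_bigr do rewrite -opprB.
  rewrite sumrN telescope_sumr// [K n.-1]cotg_psi_last// -/th -/(K 0%N).
  by ring.
(* The sine sum has the odd frequency j = 1; the cosine sums have the even frequencies j = 2(i + 1)
   < 2n. *)
have sin_le_G : \sum_(a in A) sin (a.*2%:R * th) <= G.
  have /bnd/andP[_] : (0 < 1 < n.*2)%N by lia.
  by under eq_bigr do rewrite -angleE muln1.
have cos_le_G : \sum_(i < n.-1) (K i - K i.+1)
      * \sum_(a in A) cos ((a.*2 * i.+1.*2)%:R * th) <= 2 * K 0%N * G.
  rewrite -telescope mulr_suml; apply: ler_sum => i _.
  apply: ler_wpM2l.
    by rewrite subr_ge0 cotg_psi_decr//; have := ltn_ord i; lia.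
  have /bnd/andP[+ _] : (0 < i.+1.*2 < n.*2)%N by have := ltn_ord i; lia.
  by under eq_bigr do rewrite -angleE.
have nR : 0 <= n.*2%:R :> R by [].
have := ler_wpM2l nR sin_le_G; rewrite expansion -K0E natrM2; lra.
Qed.

(** Multiplying the cotangent bound by sin th, with sin th <= th and n th = pi / 2, gives 2 k cos th
    <= (pi + 2) G. Squaring, with cos^2 th >= 1 - th^2, bounds G^2 from below. *)
Lemma sumset_bound : (0 < n)%N ->
  sumset%:R <= n%:R + #|A|%:R / 2
    + #|A|%:R ^+ 2 * (4^-1 - (1 - (PI / n.*2%:R) ^+ 2) / (PI + 2) ^+ 2) :> R.
Proof.
move=> n0; set th := PI / n.*2%:R; set k : R := #|A|%:R.
set D := k ^+ 2 + 4 * n%:R + 2 * k - 4 * sumset%:R.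
have D0 : 0 <= D.
  by apply: le_trans (sum_rep_dev); rewrite sumr_ge0.
set G := Num.sqrt D; have G0 : 0 <= G by exact: sqrtr_ge0.
have G2 : G ^+ 2 = D by exact: sqr_sqrtr.
have := sumset_cotg_bound n0 G0 G2; rewrite -/th -/k => cotgP.
have n0R : 0 < n%:R :> R by rewrite ltr0n.
have PI0 := PI_gt0.
have thE : 2 * n%:R * th = PI.
  by rewrite /th natrM2 mulrC divfK// gt_eqF// mulr_gt0.
have th0 : 0 < th by rewrite /th divr_gt0// ltr0n double_gt0.
have s0 : 0 < sin th.
  apply: sin_gt0 => //; rewrite -thE -{1}[th]mul1r ltr_pM2r//.
  by have : 1 <= n%:R :> R by [rewrite ler1n]; lra.
have s_le : sin th <= th by apply: sin_le; exact: ltW.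
have c_le1 : cos th <= 1 by apply/RleP; case: (COS_bound th).
have c_ge0 : 0 <= cos th.
  apply: cos_ge0; first exact: ltW.
  have : th <= n%:R * th by rewrite ler_peMl ?ler1n// ltW.
  by rewrite -thE; lra.
have ckG : 2 * cos th * k <= (PI + 2) * G.
  have : cos th * k <= (n%:R * sin th + cos th) * G.
    have cE : cotg th * sin th = cos th by rewrite divfK// gt_eqF.
    have -> : cos th * k = sin th * (cotg th * k) by rewrite -cE; ring.
    have -> : (n%:R * sin th + cos th) * G = sin th * ((n%:R + cotg th) * G).
      by rewrite -cE; ring.
    by apply: ler_wpM2l cotgP; exact: ltW.
  have : (n%:R * sin th + cos th) * G <= (n%:R * th + 1) * G.
    apply: ler_wpM2r => //; apply: lerD => //. by apply: ler_wpM2l.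
  have -> : n%:R * th = PI / 2 by rewrite -thE; field.
  lra.
have c2k2 : 4 * (1 - th ^+ 2) * k ^+ 2 <= (PI + 2) ^+ 2 * D.
  have : (2 * cos th * k) ^+ 2 <= ((PI + 2) * G) ^+ 2.
    rewrite ler_pXn2r// nnegrE ?mulr_ge0 ?ler0n//; lra.
  have -> : ((PI + 2) * G) ^+ 2 = (PI + 2) ^+ 2 * D by rewrite -G2; ring.
  apply: le_trans.
  have s2 : sin th ^+ 2 <= th ^+ 2 by rewrite ler_pXn2r// nnegrE ltW.
  have -> : (2 * cos th * k) ^+ 2 = 4 * cos th ^+ 2 * k ^+ 2 by ring.
  by rewrite ler_wpM2r ?sqr_ge0// ler_wpM2l// -(cos2Dsin2 th) lerBlDr lerD2l.
have PI2 : 0 < (PI + 2) ^+ 2 by rewrite exprn_gt0//; lra.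
have : (1 - th ^+ 2) / (PI + 2) ^+ 2 * k ^+ 2 <= D / 4.
  by rewrite mulrAC ler_pdivrMr//; lra.
rewrite /D; lra.
Qed.

End Sumset.

(** * Bounds on [s] and the asymptotic estimate *)

Lemma sumset_card_le (A : seq nat) : (sumset_card A <= size A * size A)%N.
Proof. by rewrite (leq_trans (size_undup _))// size_allpairs. Qed.

Lemma s_small k n : (s k n <= k * k)%N.
Proof.
apply/bigmax_leqP => A /andP[/eqP <- _].
by rewrite (leq_trans (sumset_card_le _))// size_map -cardE.
Qed.

Lemma s_bound k n : (0 < n)%N ->
  (s k n)%:R <= n%:R + k%:R / 2
    + k%:R ^+ 2 * (4^-1 - (1 - (PI / n.*2%:R) ^+ 2) / (PI + 2) ^+ 2) :> R.
Proof.
move=> n0; have PI0 := PI_gt0; set th := PI / _.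
have PI2 : 0 < (PI + 2) ^+ 2 by rewrite exprn_gt0//; lra.
(* The maximum starts from the default value 0, its value when k > n, so the bound must be
   nonnegative. *)
have c0 : 0 <= 4^-1 - (1 - th ^+ 2) / (PI + 2) ^+ 2.
  rewrite subr_ge0 ler_pdivrMr//.
  have := sqr_ge0 th; have := sqr_ge0 PI.
  have -> : (PI + 2) ^+ 2 = PI ^+ 2 + 4 * PI + 4 by ring.
  by lra.
rewrite /s; elim/big_ind: _ => [|x y xP yP|A /andP[/eqP <- A0]].
- by apply: addr_ge0; [rewrite addr_ge0 ?divr_ge0 | rewrite mulr_ge0 ?sqr_ge0].
- by rewrite /maxn; case: ifP.
- exact: sumset_bound.
Qed.

Theorem theorem2 :
  forall eps : R, (0 < eps)%R ->
  exists N : nat, forall n k : nat,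
    (N <= n)%N -> (1 <= k)%N -> (k <= n)%N ->
    (INR (s k n) <= INR n + (INR k) ^ 2 * (/ 4 - / (PI + 2) ^ 2 + eps))%R.
Proof.
move=> eps /RltP eps0; have PI0 := PI_gt0.
have c0 : 0 <= 4^-1 - ((PI + 2) ^+ 2)^-1.
  rewrite subr_ge0 lef_pV2 ?posrE ?exprn_gt0//; last by lra.
  have -> : (PI + 2) ^+ 2 = PI ^+ 2 + 4 * PI + 4 by ring.
  by have := sqr_ge0 PI; lra.
(* For k < K the trivial bound k^2 <= K^2 <= n suffices; for k >= K > 1 / eps, the linear term is
   absorbed through k <= eps k^2. *)
pose K := Num.bound eps^-1.
have K_gt : eps^-1 < K%:R by apply: archi_boundP; rewrite invr_ge0 ltW.
exists (K * K)%N => n k Kn k0 kn; apply/RleP.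
suff: (s k n)%:R <= n%:R + k%:R ^+ 2 * (4^-1 - ((PI + 2) ^+ 2)^-1 + eps).
  by rewrite !RealsE.
have [kK|Kk] := ltnP k K.
  apply: (@le_trans _ _ n%:R).
    rewrite ler_nat (leq_trans (s_small _ _))// (leq_trans _ Kn)//.
    by rewrite leq_mul// ltnW.
  by rewrite lerDl mulr_ge0 ?sqr_ge0// addr_ge0// ltW.
have n0 : (0 < n)%N by exact: leq_trans kn.
apply: le_trans (s_bound k n0) _; set th := PI / n.*2%:R.
have n0R : 0 < n%:R :> R by rewrite ltr0n.
have kR : k%:R <= n%:R :> R by rewrite ler_nat.
have k1R : 1 <= k%:R :> R by rewrite ler1n.
have thE : 2 * n%:R * th = PI.
  by rewrite /th natrM2 mulrC divfK// gt_eqF// mulr_gt0.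
have th0 : 0 < th by rewrite /th divr_gt0// ltr0n double_gt0.
(* u^2 is the error coming from th^2. Since k th <= pi / 2, it is at most 1/4, so k / 2 + u^2 <=
   k. *)
pose u := k%:R * th / (PI + 2).
have u0 : 0 <= u.
  by apply: divr_ge0; [rewrite mulr_ge0 ?(ltW th0) | lra].
have u_le : u <= 2^-1.
  rewrite /u ler_pdivrMr; last by lra.
  have : k%:R * th <= n%:R * th by rewrite ler_wpM2r// ltW.
  have -> : n%:R * th = PI / 2 by rewrite -thE; field.
  by lra.
have u2_le : u ^+ 2 <= 4^-1.
  have -> : 4^-1 = 2^-1 ^+ 2 :> R by field.
  by rewrite ler_pXn2r ?nnegrE ?invr_ge0.
have keps : k%:R <= k%:R ^+ 2 * eps.
  have : eps^-1 <= k%:R.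
    by rewrite (le_trans (ltW K_gt))// ler_nat.
  rewrite -(ler_pM2r eps0) mulVf ?gt_eqF// => ek.
  by rewrite expr2 -mulrA ler_peMr// (le_trans _ k1R).
have -> : k%:R ^+ 2 * (4^-1 - (1 - th ^+ 2) / (PI + 2) ^+ 2)
    = k%:R ^+ 2 * (4^-1 - ((PI + 2) ^+ 2)^-1) + u ^+ 2.
  by rewrite /u; field; rewrite gt_eqF//; lra.
rewrite mulrDr; lra.
Qed.
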